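(* Let $G$ be a group with identity $e$ and let $R=\bigoplus_{g\in G}R_g$ be a $G$-graded associative ring without identity element. Assume that $R$ is a PI-ring and that $R$ is a Jacobson radical ring, i.e. $J(R)=R$. If $R_e$ is nil-good, then $R$ is graded nil-good.
   Context: A ring $R$ is $G$-graded if $R=\bigoplus_{g\in G}R_g$ with $R_g$ additive subgroups and $R_gR_h\subseteq R_{gh}$ for all $g,h\in G$; elements of $\bigcup_{g}R_g$ are called homogeneous. $J(R)$ is the Jacobson radical; for a ring not assumed to have an identity, $J(R)=R$ means that every element is quasi-regular: for each $a\in R$ there is $b\in R$ with $a+b-ab=a+b-ba=0$. A ring is nil-good if each of its elements is either nilpotent or a sum of a unit and a nilpotent. A $G$-graded ring is graded nil-good if each of its homogeneous elements is either nilpotent or a sum of a homogeneous unit and a homogeneous nilpotent. (A ring without identity element has no units.) A ring $R$ is a PI-ring if there are a natural number $n$ and a polynomial $P$ in $n$ noncommuting variables with integer coefficients, at least one of whose monomials of highest degree has coefficient $1$, such that $P(r_1,\dots,r_n)=0$ for all $(r_1,\dots,r_n)\in R^n$. *)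

(* Defs.v *)
From HB Require Import structures.
From mathcomp Require Import all_boot all_order all_algebra finmap.
From mathcomp.multinomials Require Import monalg.

Set Implicit Arguments.
Unset Strict Implicit.
Unset Printing Implicit Defensive.

Import GRing.Theory.

Local Open Scope ring_scope.

(* Associative rings, not assumed to have an identity.  The addition is the
   one of [zmodType] (ring_scope) and the multiplication is the one of
   [semigroupType] (group_scope), hence the [(x * y)%g] below. *)
HB.mixin Record Zmodule_Semigroup_isRng R of GRing.Zmodule R & Semigroup R := {
  rng_mulDl : forall x y z : R, ((x + y)%R * z)%g = (x * z)%g + (y * z)%g;
  rng_mulDr : forall x y z : R, (x * (y + z)%R)%g = (x * y)%g + (x * z)%g
}.

#[short(type="rngType")]
HB.structure Definition Rng :=
  {R of Zmodule_Semigroup_isRng R & GRing.Zmodule R & Semigroup R}.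

Section NilGood.

Variable R : rngType.
Implicit Types (S : R -> Prop) (a u v : R).

(* [rng_exp a n] is a ^ (n + 1): there is no 0-th power without identity. *)
Definition rng_exp a (n : nat) : R := iter n (fun b => (a * b)%g) a.

Definition nilpotent a : Prop := exists n, rng_exp a n = 0.

(* In what follows, the predicate S stands for a subring of R, seen as a ring
   in its own right: its identity, if any, need not be an identity of R. *)
Definition is_identity S u : Prop :=
  S u /\ forall a, S a -> (u * a)%g = a /\ (a * u)%g = a.

Definition is_unit S u : Prop :=
  S u /\ exists u1 v,
    [/\ is_identity S u1, S v, (u * v)%g = u1 & (v * u)%g = u1].

Definition nil_good S : Prop :=
  forall a, S a ->
    nilpotent a \/
    exists u v, [/\ is_unit S u, S v, nilpotent v & a = u + v].

Definition whole_ring : R -> Prop := fun _ => True.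

Definition quasi_regular a : Prop :=
  exists b, a + b - (a * b)%g = 0 /\ a + b - (b * a)%g = 0.

Definition jacobson_radical_ring : Prop := forall a, quasi_regular a.

End NilGood.

Arguments whole_ring : clear implicits.
Arguments jacobson_radical_ring : clear implicits.

Section Graded.

Variables (G : groupType) (R : rngType) (Rg : G -> R -> Prop).

Record is_grading : Prop := IsGrading {
  grading0 : forall g, Rg g 0;
  gradingB : forall g x y, Rg g x -> Rg g y -> Rg g (x - y);
  gradingM : forall g h x y, Rg g x -> Rg h y -> Rg (g * h)%g (x * y)%g;
  grading_sum : forall x, exists (s : seq G) (f : G -> R),
    [/\ uniq s, forall g, Rg g (f g) & x = \sum_(g <- s) f g];
  grading_direct : forall (s : seq G) (f : G -> R),
    uniq s -> (forall g, Rg g (f g)) -> \sum_(g <- s) f g = 0 ->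
    forall g, g \in s -> f g = 0
}.

Definition homogeneous (a : R) : Prop := exists g, Rg g a.

Definition graded_nil_good : Prop :=
  forall a, homogeneous a ->
    nilpotent a \/
    exists u v, [/\ is_unit (whole_ring R) u, homogeneous u,
                    homogeneous v, nilpotent v & a = u + v].

End Graded.

Section PolynomialIdentity.

Variables (R : rngType) (n : nat).

(* The value at the empty word is a dummy: [PI_ring] only evaluates
   polynomials with zero constant term. *)
Definition word_eval (r : 'I_n -> R) (w : {fmonom 'I_n}) : R :=
  if fmonom_val w is i :: s then foldl (fun a j => (a * r j)%g) (r i) s else 0.

Definition ncpoly_eval (r : 'I_n -> R) (P : {malg int[{fmonom 'I_n}]}) : R :=
  \sum_(w <- msupp P) word_eval r w *~ P@_w.

End PolynomialIdentity.

(* Without identity, only polynomials with zero constant term have values.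
   This loses nothing when R has an identity 1: evaluating an identity with
   constant term c at 0 gives c *~ 1 = 0. *)
Definition PI_ring (R : rngType) : Prop :=
  exists (n : nat) (P : {malg int[{fmonom 'I_n}]}),
    [/\ P@_(mone : {fmonom 'I_n}) = 0,
        exists2 w, w \in msupp P &
          P@_w = 1 /\
          forall w', w' \in msupp P -> (fdeg w' <= fdeg w)%N
      & forall r : 'I_n -> R, ncpoly_eval r P = 0].

(* Main.v *)
Require Import Defs.
From mathcomp Require Import all_boot all_order all_algebra.

(** A ring all of whose elements are quasi-regular has no idempotent but 0, so
    its subring of degree 1 can only contain a unit if it is the zero ring:
    nil-good then means nil ([nil_good_quasi_regular]).  It remains to see
    that every element [a] of a component [Rg g] is nilpotent.

    If [g] has finite order [n], then [a ^ n] has degree 1, hence is nilpotent.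

    If [g] has infinite order, take [b] with [a + b - a b = 0].  In an algebra
    of formal series one would have [b = - a - a ^ 2 - a ^ 3 - ...], whose terms
    have the distinct degrees [g], [g ^ 2], [g ^ 3], ...; since [b] has finite
    support, some [a ^ k] must vanish.  To prove this without series, compare
    the components of [a + b = a b] ([quasi_inverse_components]): with [b_h]
    the component of degree [h],
      [b_(g h) = a b_h] for [h != 1],  and  [b_g = a b_1 - a].
    Among the negative powers of [g] there is one outside the support of [b],
    and the recurrence propagates this zero up to [b_1 = 0].  From there on it
    yields [b_(g ^ k) = - a ^ k] for [k >= 1], and some positive power of [g]
    is outside the support too.  Only the finitely many powers up to the size
    of the support matter, so the case distinction on the order of [g] is
    a decidable one. *)

Set Implicit Arguments.
Unset Strict Implicit.
Unset Printing Implicit Defensive.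

Import GRing.Theory.

Local Open Scope ring_scope.

Section RngTheory.

Variable R : rngType.
Implicit Types a b u x : R.

Lemma rng_mul0l x : (0%R * x)%g = 0 :> R.
Proof. by apply: (addrI (0%R * x)%g); rewrite -rng_mulDl !addr0. Qed.

Lemma rng_mul0r x : (x * 0%R)%g = 0 :> R.
Proof. by apply: (addrI (x * 0%R)%g); rewrite -rng_mulDr !addr0. Qed.

Lemma rng_mulNr a x : (a * (- x)%R)%g = - (a * x)%g :> R.
Proof. by apply: (addrI (a * x)%g); rewrite -rng_mulDr !subrr rng_mul0r. Qed.

Lemma rng_mul_sumr (I : Type) (s : seq I) (f : I -> R) a :
  (a * (\sum_(i <- s) f i)%R)%g = \sum_(i <- s) (a * f i)%g :> R.
Proof.
elim: s => [|i s IHs]; first by rewrite !big_nil rng_mul0r.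
by rewrite !big_cons rng_mulDr IHs.
Qed.

Lemma rng_expS a n : rng_exp a n.+1 = (a * rng_exp a n)%g.
Proof. by []. Qed.

Lemma rng_expD a m n :
  rng_exp a (m + n).+1 = (rng_exp a m * rng_exp a n)%g.
Proof.
elim: m => [//|m IHm].
by rewrite addSn rng_expS IHm rng_expS mulgA.
Qed.

Lemma rng_exp_rng_exp a n m :
  rng_exp (rng_exp a n) m = rng_exp a (m * n.+1 + n).
Proof.
elim: m => [//|m IHm].
by rewrite rng_expS IHm -rng_expD mulSn -addnA addSn.
Qed.

Lemma nilpotent_rng_exp a n : nilpotent (rng_exp a n) -> nilpotent a.
Proof. by case=> m am0; exists (m * n.+1 + n)%N; rewrite -rng_exp_rng_exp. Qed.

(** Multiplying [u + b - u b = 0] by [u] on the left leaves [u = 0]. *)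
Lemma quasi_regular_idempotent u : quasi_regular u -> (u * u)%g = u -> u = 0.
Proof.
case=> b [ub0 _] uu.
have : (u * (u + b - (u * b)%g)%R)%g = u.
  by rewrite !rng_mulDr rng_mulNr mulgA uu addrK.
by rewrite ub0 rng_mul0r.
Qed.

(** The identity that a unit of [S] refers to is idempotent, hence 0; the unit
    is then 0 as well, and only the nilpotent summand is left. *)
Lemma nil_good_quasi_regular (S : R -> Prop) :
  (forall a, S a -> quasi_regular a) -> nil_good S ->
  forall a, S a -> nilpotent a.
Proof.
move=> S_qr S_ng a /S_ng[//|[u [v [u_unit _ v_nil ->]]]].
case: u_unit => Su [u1 [_ [[Su1 u1_id] _ _ _]]].
have u10 : u1 = 0 by apply: quasi_regular_idempotent (S_qr _ Su1) (u1_id _ Su1).1.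
suff -> : u = 0 by rewrite add0r.
by rewrite -(u1_id _ Su).1 u10 rng_mul0l.
Qed.

End RngTheory.

(** Pigeonhole: the [(size s).+1] powers of exponent at most [size s] are
    pairwise distinct, too many to fit in [s]. *)
Lemma exists_expg_notin (G : groupType) (g : G) (s : seq G) :
  (forall i, (0 < i <= size s)%N -> (g ^+ i)%g != 1%g) ->
  exists i, [/\ (i <= size s)%N & (g ^+ i)%g \notin s].
Proof.
move=> g_ord; set powers := [seq (g ^+ i)%g | i <- iota 0 (size s).+1].
have powers_uniq : uniq powers.
  rewrite map_inj_in_uniq ?iota_uniq // => i j.
  wlog le_ij : i j / (i <= j)%N => [th|].
    by case/orP: (leq_total i j) => ? ? ? ?; [|symmetry]; apply: th.
  rewrite !mem_iota !add0n /= !ltnS => _ le_js /esym eq_ij.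
  apply/eqP; rewrite eqn_leq le_ij leqNgt; apply/negP => lt_ij.
  have /eqP[] : (g ^+ (j - i))%g != 1%g.
    by apply: g_ord; rewrite subn_gt0 lt_ij (leq_trans (leq_subr _ _)).
  by apply: (mulgI (g ^+ i)%g); rewrite -expgnDr subnKC // mulg1.
have /allPn[_ /mapP[i + ->] gi_s] : ~~ all (mem s) powers.
  apply/negP => /allP/(uniq_leq_size powers_uniq).
  by rewrite size_map size_iota ltnn.
by rewrite mem_iota add0n /= ltnS => ?; exists i.
Qed.

Lemma big_uniq_support (V : zmodType) (I : eqType) (s t : seq I) (f : I -> V) :
  uniq s -> uniq t -> {subset s <= t} -> (forall i, i \notin s -> f i = 0) ->
  \sum_(i <- t) f i = \sum_(i <- s) f i.
Proof.
move=> s_uniq t_uniq sub_st f0.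
rewrite (bigID (mem s)) /= [X in _ + X]big1 ?addr0 // -big_filter.
apply/perm_big/uniq_perm => //; first exact: filter_uniq.
move=> i; rewrite mem_filter; case: (boolP (i \in s)) => //= /sub_st.
by move=> ->.
Qed.

Section GradedRng.

Variables (G : groupType) (R : rngType) (Rg : G -> R -> Prop).
Hypothesis R_graded : is_grading Rg.

Lemma gradingD g x y : Rg g x -> Rg g y -> Rg g (x + y).
Proof.
move=> gx gy; rewrite -[y]opprK -[- y]add0r.
by do 2![apply: (gradingB R_graded) => //]; apply: (grading0 R_graded).
Qed.

Lemma rng_exp_grading g a n : Rg g a -> Rg (g ^+ n.+1)%g (rng_exp a n).
Proof.
move=> ga; elim: n => [|n IHn]; first by rewrite expg1.
by rewrite expgS; apply: (gradingM R_graded).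
Qed.

(** The components of the quasi-inverse of [a], as a total function [f] that
    vanishes off a finite list; the recurrence is the component of degree
    [g * h] of the equation [a + b = a b]. *)
Lemma quasi_inverse_components g a : Rg g a -> quasi_regular a ->
  exists (s : seq G) (f : G -> R),
    (forall h, h \notin s -> f h = 0) /\
    (forall h, f (g * h)%g = (a * f h)%g - (if h == 1%g then a else 0)).
Proof.
move=> ga [b [ab0 _]].
have [s [f0 [s_uniq f0_hom b_sum]]] := grading_sum R_graded b.
(* The decomposition of b says nothing of the values of f0 outside s. *)
pose f h := if h \in s then f0 h else 0.
have f_hom h : Rg h (f h).
  by rewrite /f; case: ifP => // _; apply: (grading0 R_graded).
have f_supp h : h \notin s -> f h = 0 by rewrite /f => /negPf->.
exists s, f; split=> // h.
(* The degrees that can occur in a, b and a b are those of g, s and s'; F x is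
   the component of degree x of a + b - a b. *)
pose s' := [seq (g * x)%g | x <- s].
pose t := undup (g :: s ++ s').
pose F x := (if x == g then a else 0) + f x - (a * f (g^-1 * x)%g)%g.
have F_hom x : Rg x (F x).
  apply: (gradingB R_graded); first apply: gradingD => //.
    by case: eqP => [->|_] //; apply: (grading0 R_graded).
  by rewrite -{1}[x](mulVKg g); apply: (gradingM R_graded).
have af_supp x : x \notin s' -> (a * f (g^-1 * x)%g)%g = 0.
  move=> xs'; rewrite f_supp ?rng_mul0r //; apply: contra xs' => xs.
  by apply/mapP; exists (g^-1 * x)%g; rewrite ?mulVKg.
have F_sum : \sum_(x <- t) F x = 0.
  transitivity (a + b - (a * b)%g) => //.
  rewrite big_split sumrN big_split /=.
  have t_uniq : uniq t by apply: undup_uniq.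
  congr (_ + _ - _).
  - rewrite (@big_uniq_support _ _ [:: g]) // ?big_seq1 ?eqxx //.
      by move=> x; rewrite inE mem_undup inE => ->.
    by move=> x; rewrite inE => /negPf->.
  - rewrite b_sum (big_uniq_support s_uniq) //.
      by apply: eq_big_seq => x; rewrite /f => ->.
    by move=> x xs; rewrite mem_undup inE mem_cat xs orbT.
  rewrite (@big_uniq_support _ _ s') //.
  - rewrite big_map b_sum rng_mul_sumr; apply: eq_big_seq => x xs.
    by rewrite mulKg /f xs.
  - by rewrite map_inj_uniq //; apply: mulgI.
  by move=> x xs; rewrite mem_undup inE mem_cat xs !orbT.
have : F (g * h)%g = 0.
  have [|] := boolP ((g * h)%g \in t).
    by apply: (grading_direct R_graded) => //; apply: undup_uniq.
  rewrite mem_undup inE mem_cat !negb_or => /and3P[/negPf gh_g gh_s gh_s'].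
  by rewrite /F gh_g f_supp // af_supp // subr0 addr0.
rewrite /F mulKg -{2}[g]mulg1 (inj_eq (mulgI g)).
by move/eqP; rewrite subr_eq0 addrC => /eqP <-; rewrite addrK.
Qed.

(** See the introduction for the idea.  The orders to exclude go up to
    [(size s).+1], one more than the descent from 1 needs: the ascent looks for
    a power of [g] outside [s] that is also different from 1, that is, outside
    the longer list [1%g :: s]. *)
Lemma quasi_regular_homogeneous_nilpotent g a :
  Rg g a -> quasi_regular a -> (forall x, Rg 1%g x -> nilpotent x) ->
  nilpotent a.
Proof.
move=> ga a_qr R1_nil.
have [s [f [f_supp fM]]] := quasi_inverse_components ga a_qr.
have [/hasP[i] | /hasPn g_ord] :=
  boolP (has (fun i => (g ^+ i)%g == 1%g) (iota 1 (size s).+1)).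
  rewrite mem_iota; case: i => // n _ /eqP gn1.
  apply: (@nilpotent_rng_exp _ _ n); apply: R1_nil; rewrite -gn1.
  exact: rng_exp_grading.
have {}g_ord i : (0 < i <= (size s).+1)%N -> (g ^+ i)%g != 1%g.
  by move=> i_bnd; apply: g_ord; rewrite mem_iota.
(* Descent: a zero of f at a negative power of g propagates up to 1. *)
have f1 : f 1%g = 0.
  have gV_ord i : (0 < i <= size s)%N -> (g^-1 ^+ i)%g != 1%g.
    case/andP=> i_gt0 i_s; rewrite expVgn invg_eq1 g_ord // i_gt0.
    exact: leqW.
  have [i [i_s]] := exists_expg_notin gV_ord; move/f_supp.
  elim: i i_s => [|i IHi] i_s fi; first by rewrite -fi.
  apply: IHi (ltnW i_s) _.
  rewrite -[(g^-1 ^+ i)%g](mulVKg g) -expgS fM fi rng_mul0r.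
  by rewrite (negPf (gV_ord _ _)) ?subr0.
(* Ascent: rng_exp a i is a to the power i + 1. *)
have f_pow i : (i <= size s)%N -> f (g ^+ i.+1)%g = - rng_exp a i.
  elim: i => [|i IHi] i_s.
    by rewrite expg1 -[g]mulg1 fM f1 rng_mul0r eqxx sub0r.
  rewrite expgS fM IHi ?(ltnW i_s) // rng_mulNr (negPf (g_ord _ _)) ?subr0 //.
  exact: leqW.
have [|i [i_s]] := @exists_expg_notin _ g (1%g :: s); first exact: g_ord.
rewrite inE negb_or => /andP[].
case: i i_s => [|i] i_s; first by rewrite eqxx.
move=> _ /f_supp; rewrite f_pow // => /eqP; rewrite oppr_eq0 => /eqP ai0.
by exists i.
Qed.

End GradedRng.

Theorem theorem3p2 (G : groupType) (R : rngType) (Rg : G -> R -> Prop)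
  (R_graded : is_grading Rg)
  (R_noid : ~ exists u : R, is_identity (whole_ring R) u)
  (R_PI : PI_ring R)
  (R_rad : jacobson_radical_ring R)
  (Re_nil_good : nil_good (Rg 1%g)) :
  graded_nil_good Rg.
Proof.
move=> a [g ga]; left.
apply: (quasi_regular_homogeneous_nilpotent R_graded ga) => //.
by apply: nil_good_quasi_regular Re_nil_good => x _.
Qed.
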